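(* Let $\{\beta_n\}_{n=0}^\infty$ be a sequence of positive real numbers with $\beta_0=1$ such that the operator $M_z$ of multiplication by $z$ is a well-defined bounded operator on the weighted Hardy space $H^2(\beta)$, and suppose that $M_z$ is strictly cyclic on $H^2(\beta)$. Let $F:H^2(\beta)\to\mathbb{C}$ be a linear functional such that $F(1)=1$ and $F(f)\neq 0$ for every invertible $f\in H^2(\beta)$. Then there exists a complex scalar $w$ with $|w|\le r(M_z)$ such that $F(f)=f(w)$ for all $f\in H^2(\beta)$.
   Context: Weighted Hardy space: for a sequence $\{\beta_n\}_{n=0}^\infty$ of positive numbers with $\beta_0=1$, $H^2(\beta)$ is the Hilbert space of formal power series $f(z)=\sum_{n=0}^\infty a_n z^n$ with complex coefficients such that $\|f\|_\beta^2=\sum_{n=0}^\infty |a_n|^2\beta_n^2<\infty$; the sequence $\{z^n\}_{n\ge 0}$ is an orthogonal basis with $\|z^n\|_\beta=\beta_n$. No convergence of the series at any complex number is assumed a priori. The operator $M_z$ on $H^2(\beta)$ is determined by $M_z(z^n)=z^{n+1}$; it is a well-defined bounded operator if and only if $\sup_n \beta_{n+1}/\beta_n<\infty$. Its spectral radius is denoted $r(M_z)$. Strictly cyclic: a bounded operator $T$ on a Hilbert space $\mathcal{H}$ is strictly cyclic if there exists $x_0\in\mathcal{H}$ such that $\{Rx_0: R\in\mathcal{W}[T]\}=\mathcal{H}$, where $\mathcal{W}[T]$ is the closure, in the weak operator topology, of the algebra of polynomials in $T$. Let $H^\infty(\beta)$ be the set of formal power series $\phi$ such that $\phi f\in H^2(\beta)$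 for all $f\in H^2(\beta)$, where products are formal Cauchy products. It is known that $M_z$ is strictly cyclic if and only if $H^2(\beta)=H^\infty(\beta)$ as sets, so in that case $H^2(\beta)$ is a commutative unital algebra under the Cauchy product. An element $f\in H^2(\beta)$ is invertible if there is $g\in H^2(\beta)$ with $fg=1$. It is also known that, when $M_z$ is strictly cyclic, every power series $f=\sum a_nz^n$ in $H^2(\beta)$ converges absolutely at every $w\in\mathbb{C}$ with $|w|\le r(M_z)$; $f(w)$ denotes the sum $\sum_{n=0}^\infty a_n w^n$. The functional $F$ is not assumed to be continuous. *)

(* Defs.v *)
From HB Require Import structures.
From mathcomp Require Import all_boot all_order all_algebra.
From mathcomp Require Import all_classical all_reals all_analysis.
From mathcomp Require Import complex ring.

Set Implicit Arguments.
Unset Strict Implicit.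
Unset Printing Implicit Defensive.

Import Order.TTheory GRing.Theory Num.Theory.
Import numFieldNormedType.Exports.
Import Normc.

Local Open Scope classical_set_scope.
Local Open Scope ring_scope.
Local Open Scope complex_scope.

(* The usual topology of the complex plane, given by the modulus. *)
HB.instance Definition _ (R : rcfType) := PseudoPointedMetric.copy R[i] R[i]^o.
HB.instance Definition _ (R : rcfType) := NormedModule.copy R[i] R[i]^o.

(* A formal power series is identified with its sequence of coefficients;
   [normc] is the R-valued modulus. *)
Definition h2_summable (R : realType) (beta : nat -> R) : {pred nat -> R[i]} :=
  [pred a | `[< cvgn (series (fun n => normc (a n) ^+ 2 * beta n ^+ 2)) >]].

Record H2 (R : realType) (beta : nat -> R) := MkH2 {
  h2_coef :> nat -> R[i];
  h2_coefP : h2_coef \in h2_summable beta }.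

HB.instance Definition _ (R : realType) (beta : nat -> R) :=
  [isSub for @h2_coef R beta].
HB.instance Definition _ (R : realType) (beta : nat -> R) :=
  [Choice of H2 beta by <:].

Lemma h2_submod_closed (R : realType) (beta : nat -> R) :
  submod_closed (h2_summable beta).
Proof.
split=> [|c a b].
  rewrite inE.
  rewrite (_ : (fun n => _) = (fun=> 0)); last first.
    by apply/funext => n; rewrite normc0 expr0n mul0r.
  rewrite (_ : series _ = cst 0); first exact: is_cvg_cst.
  by apply/funext => n; rewrite /series /= big1.
rewrite !inE => ca cb.
pose u n := 2 * normc c ^+ 2 * (normc (a n) ^+ 2 * beta n ^+ 2)
            + 2 * (normc (b n) ^+ 2 * beta n ^+ 2).
have cu : cvgn (series u).
  apply: (@is_cvg_seriesD _ (_ *: _) (_ *: _)).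
    exact: is_cvg_seriesZ ca.
  exact: is_cvg_seriesZ cb.
have normc_ge0 (x : R[i]) : 0 <= normc x by case: x => x y /=; rewrite sqrtr_ge0.
apply: (series_le_cvg _ _ _ cu) => n.
- by rewrite mulr_ge0 ?sqr_ge0.
- by rewrite /u addr_ge0 ?(sqr_ge0, mulr_ge0).
set x := normc c * normc (a n); set y := normc (b n).
have x0 : 0 <= x by rewrite mulr_ge0.
have y0 : 0 <= y by exact: normc_ge0.
have -> : u n = (2 * x ^+ 2 + 2 * y ^+ 2) * beta n ^+ 2.
  by rewrite /u /x /y; ring.
rewrite ler_wpM2r ?sqr_ge0//; apply: (@le_trans _ _ ((x + y) ^+ 2)).
  rewrite ler_pXn2r// ?nnegrE ?addr_ge0//.
  by rewrite /x -normcM; exact: le_normcD.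
have -> : 2 * x ^+ 2 + 2 * y ^+ 2 = (x + y) ^+ 2 + (x - y) ^+ 2 by ring.
by rewrite lerDl sqr_ge0.
Qed.

HB.instance Definition _ (R : realType) (beta : nat -> R) :=
  GRing.isSubmodClosed.Build R[i] (nat -> R[i]) (h2_summable beta)
    (h2_submod_closed beta).
HB.instance Definition _ (R : realType) (beta : nat -> R) :=
  [SubChoice_isSubLmodule of H2 beta by <:].

Lemma h2_mon_subproof (R : realType) (beta : nat -> R) (n : nat) :
  (fun k => (k == n)%:R : R[i]) \in h2_summable beta.
Proof.
rewrite inE -(is_cvg_series_restrict n.+1).
rewrite (_ : [sequence _]_n = cst 0); first exact: is_cvg_cst.
apply/funext => m /=; rewrite big_nat_cond big1// => k.
by rewrite andbT => /andP[/gtn_eqF -> _]; rewrite normc0 expr0n mul0r.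
Qed.

(* The monomial z ^ n; in particular [h2_mon beta 0] is the constant 1. *)
Definition h2_mon (R : realType) (beta : nat -> R) (n : nat) : H2 beta :=
  MkH2 (h2_mon_subproof beta n).

Definition h2_norm (R : realType) (beta : nat -> R) (f : H2 beta) : R :=
  Num.sqrt (limn (series (fun n => normc (f n) ^+ 2 * beta n ^+ 2))).

Definition h2_dot (R : realType) (beta : nat -> R) (f g : H2 beta) : R[i] :=
  limn (series (fun n => f n * (g n)^* * (beta n ^+ 2)%:C)).

(* The formal Cauchy product; it need not belong to H2 beta. *)
Definition cauchy_prod (R : realType) (a b : nat -> R[i]) : nat -> R[i] :=
  fun n => \sum_(k < n.+1) a k * b (n - k)%N.

Definition h2_invertible (R : realType) (beta : nat -> R) (f : H2 beta) :=
  exists g : H2 beta, cauchy_prod f g = h2_mon beta 0.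

Record bounded_op (R : realType) (beta : nat -> R) := BoundedOp {
  bop_fun :> {linear H2 beta -> H2 beta};
  bop_bounded : exists K : R, forall f, h2_norm (bop_fun f) <= K * h2_norm f }.

(* [initial_topology] asks for a choiceType. *)
HB.instance Definition _ (R : realType) (beta : nat -> R) :=
  gen_eqMixin (bounded_op beta).
HB.instance Definition _ (R : realType) (beta : nat -> R) :=
  gen_choiceMixin (bounded_op beta).

Definition spectrum (R : realType) (beta : nat -> R) (T : bounded_op beta) :
    set R[i] :=
  [set l | ~ exists S : bounded_op beta, forall f,
     S (T f - l *: f) = f /\ T (S f) - l *: S f = f].

Definition spectral_radius (R : realType) (beta : nat -> R)
    (T : bounded_op beta) : R :=
  sup [set normc l | l in spectrum T].

Definition op_coef (R : realType) (beta : nat -> R) (T : bounded_op beta) :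
    {ptws (H2 beta * H2 beta) -> R[i]} :=
  fun xy => h2_dot (T xy.1) xy.2.

(* The weak operator topology, as the coarsest topology making T |-> <T x, y>
   continuous for all x and y. *)
Definition wot (R : realType) (beta : nat -> R) : topologicalType :=
  initial_topology (@op_coef R beta).

Definition poly_ops (R : realType) (beta : nat -> R) (T : bounded_op beta) :
    set (bounded_op beta) :=
  [set A | exists p : {poly R[i]},
     forall f, A f = \sum_(k < size p) p`_k *: iter k T f].

Definition wot_algebra (R : realType) (beta : nat -> R) (T : bounded_op beta) :
    set (bounded_op beta) :=
  closure (poly_ops T : set (wot beta)).

Definition strictly_cyclic (R : realType) (beta : nat -> R)
    (T : bounded_op beta) :=
  exists x0 : H2 beta,
    [set (A : bounded_op beta) x0 | A in wot_algebra T] = setT.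

(* Main.v *)
Require Import Defs.
From HB Require Import structures.
From mathcomp Require Import all_boot all_order all_algebra.
From mathcomp Require Import all_classical all_reals all_analysis.
From mathcomp Require Import complex ring lra.

(** The functional [F] turns out to be evaluation at [w = F z], and the proof is
    the theorem of Gleason, Kahane and Zelazko carried out by hand on [H2 beta].

    Strict cyclicity makes [H2 beta] a Banach algebra
    ([strictly_cyclic_prod]).  An operator in the weakly closed algebra of [Mz]
    is multiplication by the image of the constant 1 ([wot_algebra_Mz]), because
    this is a relation between finitely many coefficients.  If [x0] is the cyclic
    vector and [phi] the power series of the operator sending [x0] to 1, then
    [phi x0 = 1] and the operator sending [x0] to [g] is multiplication by
    [phi g].  So [(g, f) |-> phi g f] is everywhere defined, symmetric and
    separately bounded, hence bounded ([h2_bilinear_bounded]).  A polynomial [p]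
    close to [x0] then makes [phi p = 1 + phi (p - x0)] a small perturbation of
    1, so every [g] is some [phi p h], and [g f = p (phi h f)] lies in [H2 beta]
    with control of the norm.  For a suitable [C] this gives
    [|f g| <= C |f| |g|], and Neumann series invert [1 + x] as soon as
    [2 C |x| <= 1].

    In such an algebra a unital functional that does not vanish on invertible
    elements is multiplicative ([scalar_multiplicative]): if [F x = 0], the
    polynomial [t |-> F ((1 + t x) ^+ n)] has no root in a fixed disc, its
    coefficient of degree 1 vanishes and its coefficient of degree 2 is
    ['C(n, 2) F (x ^+ 2)]; by Newton's identity the latter is O(n), since it is
    minus half the sum of the squares of at most [n] bounded inverse roots.
    Hence [F (x ^+ 2) = 0], and polarization concludes.

    Finally [F] is bounded, as [f - F f] is never invertible
    ([invertible_scalar_bounded]), so [F] is determined by the values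
    [F (z ^+ n) = w ^+ n]; and [w] lies in the spectrum of [Mz], which is bounded
    by the same Neumann series, as a resolvent at [w] would invert [z - w]. *)

Import Order.TTheory GRing.Theory Num.Theory.
Import numFieldNormedType.Exports.
Import Normc.

Local Open Scope classical_set_scope.
Local Open Scope ring_scope.
Local Open Scope complex_scope.

Set Implicit Arguments.
Unset Strict Implicit.
Unset Printing Implicit Defensive.

(** * The modulus, and sequences decreasing at least geometrically *)

Lemma normc_ge0 (R : realType) (x : R[i]) : 0 <= normc x.
Proof. by case: x => a b /=; rewrite sqrtr_ge0. Qed.

Lemma normcX (R : realType) (x : R[i]) n : normc (x ^+ n) = normc x ^+ n.
Proof. by elim: n => [|n IHn]; rewrite ?normc1 // !exprS normcM IHn. Qed.

Lemma le_normc_sum (R : realType) (I : Type) (s : seq I) (a : I -> R[i]) :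
  normc (\sum_(i <- s) a i) <= \sum_(i <- s) normc (a i).
Proof.
elim: s => [|i s IHs]; first by rewrite !big_nil normc0.
by rewrite !big_cons (le_trans (le_normcD _ _)) // lerD2l.
Qed.

Lemma normc_real (R : realType) (r : R) : normc r%:C = `|r|.
Proof. by rewrite /= expr0n addr0 sqrtr_sqr. Qed.

Lemma sqr_normc_ReIm (R : realType) (z : R[i]) :
  normc z ^+ 2 = complex.Re z ^+ 2 + complex.Im z ^+ 2.
Proof. by case: z => a b; rewrite /= sqr_sqrtr // addr_ge0 ?sqr_ge0. Qed.

Lemma le_Re_normc (R : realType) (z : R[i]) : `|complex.Re z| <= normc z.
Proof.
rewrite -ler_sqr ?nnegrE ?normc_ge0 // real_normK ?num_real //.
by rewrite sqr_normc_ReIm lerDl sqr_ge0.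
Qed.

Lemma le_Im_normc (R : realType) (z : R[i]) : `|complex.Im z| <= normc z.
Proof.
rewrite -ler_sqr ?nnegrE ?normc_ge0 // real_normK ?num_real //.
by rewrite sqr_normc_ReIm lerDr sqr_ge0.
Qed.

(** How limit arguments are concluded: [x] is bounded by a quantity that tends
    to 0. *)
Lemma le0_small (R : realType) (c x : R) :
  (forall e, 0 < e -> x <= c * e) -> x <= 0.
Proof.
move=> xe; apply/ler_addgt0Pl => e e0; rewrite addr0.
have d0 : 0 < 1 + `|c| by rewrite ltr_pwDl.
rewrite (le_trans (xe _ (divr_gt0 e0 d0))) // mulrA ler_pdivrMr // mulrC.
by rewrite ler_pM2l // (le_trans (ler_norm _)) // lerDr.
Qed.

Lemma halving_small (R : realType) (d : nat -> R) : (forall n, 0 <= d n) ->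
  (forall n, 2 * d n.+1 <= d n) -> forall e, 0 < e -> exists n, d n <= e.
Proof.
move=> d0 dS e e0.
have dn n : n.+1%:R * d n <= d 0%N.
  elim: n => [|n IHn]; first by rewrite mul1r.
  rewrite (le_trans _ IHn) // (le_trans _ (ler_wpM2l _ (dS n))) // mulrA.
  by rewrite ler_wpM2r // -natrM ler_nat muln2 -addnn addnS ltnS leq_addr.
have := archi_boundP (divr_ge0 (d0 0%N) (ltW e0)); set n := Num.bound _ => ltn.
exists n; rewrite -(ler_pM2l (ltr0Sn R n)) (le_trans (dn n)) // -ler_pdivrMr //.
by rewrite (le_trans (ltW ltn)) // ler_nat.
Qed.

(** Applied to the real and imaginary parts of the coefficients of a Cauchy
    sequence of [H2 beta]. *)
Lemma halving_cvg (R : realType) (u d : nat -> R) : (forall n, 0 <= d n) ->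
  (forall n, 2 * d n.+1 <= d n) ->
  (forall n k, `|u (n + k)%N - u n| <= d n) -> cvgn u.
Proof.
move=> d0 dS ud; apply: cauchy_cvg; apply: cauchy_exP => e e0.
have [n dn] := halving_small d0 dS (divr_gt0 e0 (ltr0Sn R 1)).
exists (u n); suff : \forall m \near \oo, ball (u n) e (u m) by [].
near=> m; have nm : (n <= m)%N by near: m; exact: nbhs_infty_ge.
rewrite /ball /= distrC -(subnKC nm) (le_lt_trans (ud _ _)) // (le_lt_trans dn) //.
by rewrite ltr_pdivrMr // ltr_pMr // ltr1n.
Unshelve. all: by end_near. Qed.

(** * The norm of the weighted Hardy space *)

Section Norm.
Variables (R : realType) (beta : nat -> R).
Hypothesis beta_gt0 : forall n, 0 < beta n.

Lemma h2_coefD (f g : H2 beta) n : (f + g) n = f n + g n. Proof. by []. Qed.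
Lemma h2_coefB (f g : H2 beta) n : (f - g) n = f n - g n. Proof. by []. Qed.
Lemma h2_coefZ c (f : H2 beta) n : (c *: f) n = c * f n. Proof. by []. Qed.
Lemma h2_coef_sum (I : Type) (s : seq I) (P : pred I) (f : I -> H2 beta) n :
  (\sum_(i <- s | P i) f i) n = \sum_(i <- s | P i) f i n.
Proof.
elim: s => [|i s IHs]; first by rewrite !big_nil.
by rewrite !big_cons; case: ifP => _ //; rewrite h2_coefD IHs.
Qed.

(** Everything about the norm is read off from these partial sums: a bound
    uniform in [n] gives both membership in [H2 beta] and a bound of the norm,
    and for fixed [n] the sum is continuous in each coefficient. *)
Definition psum2 (a : nat -> R[i]) (n : nat) : R :=
  \sum_(k < n) normc (a k) ^+ 2 * beta k ^+ 2.

Lemma series_psum2 (a : nat -> R[i]) :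
  series (fun n => normc (a n) ^+ 2 * beta n ^+ 2) = psum2 a.
Proof. by apply/funext => n; rewrite /series /= big_mkord. Qed.

Lemma psum2_ge0 a n : 0 <= psum2 a n.
Proof. by rewrite sumr_ge0 // => k _; rewrite mulr_ge0 ?sqr_ge0. Qed.

Lemma psum2_nd a : nondecreasing_seq (psum2 a).
Proof.
apply/nondecreasing_seqP => n; rewrite /psum2 big_ord_recr /= lerDl.
by rewrite mulr_ge0 ?sqr_ge0.
Qed.

(** Minkowski's inequality, by the weighted convexity bound
    [(x + y)^2 <= (1 + s/r) x^2 + (1 + r/s) y^2]: with [r] and [s] the two norms
    the weights are those for which summation gives exactly [(r + s)^2]. *)
Lemma psum2D a b r s n : 0 <= r -> 0 <= s ->
  psum2 a n <= r ^+ 2 -> psum2 b n <= s ^+ 2 -> psum2 (a + b) n <= (r + s) ^+ 2.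
Proof.
move=> r0 s0 ar bs; have addE k : (a + b) k = a k + b k by [].
have null c : psum2 c n <= 0 -> forall k : 'I_n, normc (c k) = 0.
  move=> c0; have /eqP : psum2 c n = 0 by apply/eqP; rewrite eq_le c0 psum2_ge0.
  rewrite psumr_eq0 => [/allP c_eq0 k|k _]; last by rewrite mulr_ge0 ?sqr_ge0.
  have := c_eq0 k (mem_index_enum k); rewrite /= mulf_eq0 !sqrf_eq0.
  by rewrite (gt_eqF (beta_gt0 _)) orbF => /eqP.
(* A null norm makes the weights meaningless, but then the series vanishes. *)
have [r_eq0|rN0] := eqVneq r 0.
  rewrite r_eq0 add0r (le_trans _ bs) // ler_sum // => k _.
  rewrite addE (eq0_normc (null a _ k)) ?add0r //.
  by rewrite (le_trans ar) // r_eq0 expr0n.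
have [s_eq0|sN0] := eqVneq s 0.
  rewrite s_eq0 addr0 (le_trans _ ar) // ler_sum // => k _.
  rewrite addE (eq0_normc (null b _ k)) ?addr0 //.
  by rewrite (le_trans bs) // s_eq0 expr0n.
have rp : 0 < r by rewrite lt0r rN0.
have sp : 0 < s by rewrite lt0r sN0.
have -> : (r + s) ^+ 2 = (1 + s / r) * r ^+ 2 + (1 + r / s) * s ^+ 2.
  by field; rewrite rN0 sN0.
apply: (@le_trans _ _ ((1 + s / r) * psum2 a n + (1 + r / s) * psum2 b n)); last first.
  by rewrite lerD // ler_wpM2l ?addr_ge0 ?divr_ge0.
rewrite /psum2 !mulr_sumr -big_split /= ler_sum // => k _.
set x := normc (a k); set y := normc (b k).
have -> : (1 + s / r) * (x ^+ 2 * beta k ^+ 2) + (1 + r / s) * (y ^+ 2 * beta k ^+ 2) =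
  ((1 + s / r) * x ^+ 2 + (1 + r / s) * y ^+ 2) * beta k ^+ 2 by ring.
rewrite ler_wpM2r ?sqr_ge0 //.
apply: (@le_trans _ _ ((x + y) ^+ 2)).
  by rewrite lerXn2r ?nnegrE ?addr_ge0 ?normc_ge0 // le_normcD.
rewrite -subr_ge0.
have -> : (1 + s / r) * x ^+ 2 + (1 + r / s) * y ^+ 2 - (x + y) ^+ 2 =
  (s * x - r * y) ^+ 2 / (r * s) by field; rewrite rN0 sN0.
by rewrite divr_ge0 ?sqr_ge0 ?mulr_ge0.
Qed.

Lemma psum2_cvg a r : (forall n, psum2 a n <= r) -> cvgn (psum2 a).
Proof.
move=> ar; apply: nondecreasing_is_cvgn; first exact: psum2_nd.
by exists r => _ [n _ <-].
Qed.

Lemma psum2_h2 a r : (forall n, psum2 a n <= r) -> a \in h2_summable beta.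
Proof. by move=> ar; rewrite inE series_psum2; apply: psum2_cvg ar. Qed.

Lemma h2_cvg (f : H2 beta) : cvgn (psum2 f).
Proof. by have := h2_coefP f; rewrite inE series_psum2. Qed.

Lemma h2_norm_ge0 (f : H2 beta) : 0 <= h2_norm f.
Proof. exact: sqrtr_ge0. Qed.

Lemma psum2_le (f : H2 beta) n : psum2 f n <= h2_norm f ^+ 2.
Proof.
have lim_ge : psum2 f n <= limn (psum2 f).
  apply: nondecreasing_cvgn_le; [exact: psum2_nd|exact: h2_cvg].
by rewrite /h2_norm series_psum2 sqr_sqrtr // (le_trans (psum2_ge0 f n) lim_ge).
Qed.

Lemma h2_norm_le (f : H2 beta) r : 0 <= r ->
  (forall n, psum2 f n <= r ^+ 2) -> h2_norm f <= r.
Proof.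
move=> r0 fr; rewrite -(ger0_norm r0) -sqrtr_sqr /h2_norm series_psum2.
by rewrite ler_wsqrtr // limr_le //; [exact: h2_cvg|near=> n].
Unshelve. all: by end_near. Qed.

Lemma h2_normD (f g : H2 beta) : h2_norm (f + g) <= h2_norm f + h2_norm g.
Proof.
apply: h2_norm_le => [|n]; first by rewrite addr_ge0 ?h2_norm_ge0.
by apply: psum2D; rewrite ?h2_norm_ge0 // psum2_le.
Qed.

Lemma h2_normZ_le (c : R[i]) (f : H2 beta) : h2_norm (c *: f) <= normc c * h2_norm f.
Proof.
apply: h2_norm_le => [|n]; first by rewrite mulr_ge0 ?normc_ge0 ?h2_norm_ge0.
rewrite exprMn (le_trans _ (ler_wpM2l (sqr_ge0 _) (psum2_le f n))) //.
rewrite /psum2 mulr_sumr ler_sum // => k _.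
by rewrite h2_coefZ normcM exprMn -mulrA.
Qed.

Lemma h2_normZ (c : R[i]) (f : H2 beta) : h2_norm (c *: f) = normc c * h2_norm f.
Proof.
apply/eqP; rewrite eq_le h2_normZ_le /=.
have [->|cN0] := eqVneq c 0; first by rewrite normc0 mul0r h2_norm_ge0.
have c0 : 0 < normc c.
  by rewrite lt0r normc_ge0 andbT; apply: contra cN0 => /eqP/eq0_normc ->.
rewrite -ler_pdivlMl // -normcV (le_trans _ (h2_normZ_le _ _)) //.
by rewrite scalerA mulVf // scale1r.
Qed.

Lemma h2_normN (f : H2 beta) : h2_norm (- f) = h2_norm f.
Proof.
suff le (g : H2 beta) : h2_norm (- g) <= h2_norm g.
  by apply/eqP; rewrite eq_le le -{1}[f]opprK le.
by rewrite -[- g]scaleN1r h2_normZ normcN normc1 mul1r.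
Qed.

Lemma h2_normB (f g : H2 beta) : h2_norm (f - g) = h2_norm (g - f).
Proof. by rewrite -h2_normN opprB. Qed.

Lemma h2_norm0 : h2_norm (0 : H2 beta) = 0.
Proof. by rewrite -(scale0r (0 : H2 beta)) h2_normZ normc0 mul0r. Qed.

Lemma h2_coef_le (f : H2 beta) n : normc (f n) * beta n <= h2_norm f.
Proof.
rewrite -ler_sqr ?nnegrE ?mulr_ge0 ?normc_ge0 ?h2_norm_ge0 ?(ltW (beta_gt0 _)) //.
rewrite (le_trans _ (psum2_le f n.+1)) // /psum2 big_ord_recr /= exprMn lerDr.
exact: psum2_ge0.
Qed.

Lemma h2P (f g : H2 beta) : (forall n, f n = g n) -> f = g.
Proof. by move=> fg; apply: val_inj; apply/funext. Qed.

Lemma h2_norm_eq0 (f : H2 beta) : h2_norm f <= 0 -> f = 0.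
Proof.
move=> f0; apply: h2P => n; apply: eq0_normc; apply/eqP.
rewrite eq_le normc_ge0 andbT -(pmulr_lle0 _ (beta_gt0 n)).
exact: le_trans (h2_coef_le _ _) f0.
Qed.

End Norm.

(** * Completeness and the uniform boundedness principle *)

Section Completeness.
Variables (R : realType) (beta : nat -> R).
Hypothesis beta_gt0 : forall n, 0 < beta n.

(** Completeness, with an explicit rate.  The coefficients converge, because each
    is bounded by the norm; as a partial sum of the norm involves finitely many
    coefficients, the estimate for [x m - x n] survives the limit in [m]. *)
Lemma h2_complete (x : nat -> H2 beta) (d : nat -> R) :
  (forall n, 2 * d n.+1 <= d n) -> (forall n, h2_norm (x n.+1 - x n) <= d n) ->
  exists y : H2 beta, forall n, h2_norm (y - x n) <= 2 * d n.
Proof.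
move=> dS xd.
have d0 n : 0 <= d n by exact: le_trans (h2_norm_ge0 _) (xd n).
have xx n k : h2_norm (x (n + k)%N - x n) <= 2 * d n.
  (* The subtracted term makes the estimate inductive. *)
  suff : h2_norm (x (n + k)%N - x n) <= 2 * d n - 2 * d (n + k)%N.
    by move=> /le_trans -> //; rewrite gerBl mulr_ge0.
  elim: k => [|k IHk]; first by rewrite addn0 !subrr h2_norm0.
  rewrite -(subrKA (x (n + k)%N)) (le_trans (h2_normD beta_gt0 _ _)) //.
  by move: IHk (xd (n + k)%N) (dS (n + k)%N); rewrite addnS; lra.
have coef_le (P : R[i] -> R) (Pn : forall z, `|P z| <= normc z)
    (PB : {morph P : a b / a - b}) j : cvgn (fun n => P (x n j)).
  apply: (@halving_cvg _ _ (fun n => 2 * d n / beta j)) => [n|n|n k].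
  - by rewrite divr_ge0 ?mulr_ge0 // ltW.
  - by rewrite mulrA ler_pM2r ?invr_gt0 // ler_wpM2l.
  rewrite -PB (le_trans (Pn _)) // ler_pdivlMr //.
  exact: le_trans (h2_coef_le beta_gt0 (x (n + k)%N - x n) j) (xx n k).
have ReB : {morph @complex.Re R : a b / a - b} by case=> ? ? [].
have ImB : {morph @complex.Im R : a b / a - b} by case=> ? ? [].
have cRe j : cvgn (fun n => complex.Re (x n j)) by apply: coef_le => // z; exact: le_Re_normc.
have cIm j : cvgn (fun n => complex.Im (x n j)) by apply: coef_le => // z; exact: le_Im_normc.
have cvg_sqrB (u : nat -> R) (l c : R) : u m @[m --> \oo] --> l ->
    (u m - c) ^+ 2 @[m --> \oo] --> (l - c) ^+ 2.
  by move=> ul; apply: (@cvgM _ _ _ _ (fun m => u m - c) (fun m => u m - c));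
    apply: cvgB => //; exact: cvg_cst.
pose y j : R[i] := limn (fun n => complex.Re (x n j)) +i* limn (fun n => complex.Im (x n j)).
have yx n N : psum2 beta (fun k => y k - x n k) N <= (2 * d n) ^+ 2.
  have cvg_psum : psum2 beta (fun k => x m k - x n k) N @[m --> \oo] -->
      psum2 beta (fun k => y k - x n k) N.
    apply: cvg_big => [|j _]; first by exact: add_continuous.
    apply: cvgM; last exact: cvg_cst.
    rewrite sqr_normc_ReIm ReB ImB (_ : (fun m : nat => _) =
      (fun m => (complex.Re (x m j) - complex.Re (x n j)) ^+ 2 +
                (complex.Im (x m j) - complex.Im (x n j)) ^+ 2)).
      by apply: cvgD; apply: cvg_sqrB; [exact: cRe|exact: cIm].
    by apply/funext => m; rewrite sqr_normc_ReIm ReB ImB.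
  rewrite -(cvg_lim _ cvg_psum) //; apply: limr_le.
    by apply/cvg_ex; eexists; exact: cvg_psum.
  near=> m; have nm : (n <= m)%N by near: m; exact: nbhs_infty_ge.
  rewrite -(subnKC nm) (le_trans (psum2_le (x (n + (m - n))%N - x n) N)) //.
  by rewrite ler_pXn2r ?nnegrE ?h2_norm_ge0 ?mulr_ge0.
have yx0 := psum2_h2 (yx 0%N).
exists (MkH2 yx0 + x 0%N) => n; apply: h2_norm_le; first by rewrite mulr_ge0.
move=> N; rewrite (_ : h2_coef _ = (fun k => y k - x n k)) //.
by apply/funext => k; rewrite h2_coefB h2_coefD /= subrK.
Unshelve. all: by end_near. Qed.

(** [h] is the limit of [x n.+1 = g - T (x n)], a contraction of ratio 1/2. *)
Lemma h2_neumann (T : H2 beta -> H2 beta) (g : H2 beta) :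
  {morph T : x y / x - y} -> (forall x, 2 * h2_norm (T x) <= h2_norm x) ->
  exists h, h + T h = g /\ h2_norm h <= 2 * h2_norm g.
Proof.
move=> TB Th; pose x := fix x n := if n is n'.+1 then g - T (x n') else 0.
have T0 : T 0 = 0 by have := TB 0 0; rewrite !subrr.
pose d := fix d n := if n is n'.+1 then h2_norm (x n'.+2 - x n'.+1) else h2_norm g.
have xS n : x n.+2 - x n.+1 = T (x n - x n.+1).
  by rewrite TB /= opprB addrC addrA subrK.
have dS n : 2 * d n.+1 <= d n.
  have -> : d n = h2_norm (x n.+1 - x n) by case: n => [|n] //=; rewrite T0 !subr0.
  by rewrite [d _]/(h2_norm (x n.+2 - x n.+1)) xS h2_normB Th.
have [n|h hx] := @h2_complete x d dS.
  by case: n => [|n] //=; rewrite T0 !subr0.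
exists h; split; last by have := hx 0%N; rewrite /= subr0.
apply/eqP; rewrite -subr_eq0; apply/eqP; apply: (h2_norm_eq0 beta_gt0).
(* The residual is [(h - x n.+1) + T (h - x n)], of norm at most [2 * d n]. *)
apply: (@le0_small _ 2) => e e0.
have d0 n : 0 <= d n by case: n => [|n]; exact: h2_norm_ge0.
have [n dn] := halving_small d0 dS e0.
have -> : h + T h - g = (h - x n.+1) + T (h - x n).
  by rewrite TB /= opprB addrACA [T _ - g - _]addrAC subrr add0r.
rewrite (le_trans (h2_normD beta_gt0 _ _)) //.
move: (hx n.+1) (hx n) (Th (h - x n)) (dS n) (d0 n); lra.
Qed.

(** A gliding hump.  Were [b] unbounded, one could choose [g n] and [f n] in
    the unit ball with [b (g n) (f n)] as large as desired and put
    [y = \sum_n d n * f n].  In [b (g n) y] the terms before [n] are controlled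
    through symmetry by a quantity known when [g n] and [f n] are chosen, the
    terms after [n] are made harmless by choosing [d n.+1] small with respect to
    [g n], and the [n]-th one dominates; but [b (g n) y = b y (g n)] is bounded
    in [n]. *)
Lemma h2_bilinear_bounded (b : H2 beta -> H2 beta -> H2 beta) :
  (forall f g, b f g = b g f) -> (forall f, linear (b f)) ->
  (forall f, exists N : R, forall g, h2_norm (b f g) <= N * h2_norm g) ->
  exists2 C : R, 0 < C & forall f g, h2_norm (b f g) <= C * h2_norm f * h2_norm g.
Proof.
move=> bC blin /choice[N bN]; apply: contrapT => unbounded.
have bZ f c g : b f (c *: g) = c *: b f g.
  have b0 : b f 0 = 0.
    have := blin f 1 0 0; rewrite !scale1r !addr0 => /eqP.
    by rewrite -subr_eq0 opprD addrA subrr sub0r oppr_eq0 => /eqP.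
  by have := blin f c g 0; rewrite b0 !addr0.
have bD f g h : b f (g + h) = b f g + b f h by have := blin f 1 g h; rewrite !scale1r.
have witness (c : R) : exists fg : H2 beta * H2 beta,
    [/\ h2_norm fg.1 <= 1, h2_norm fg.2 <= 1 & c < h2_norm (b fg.1 fg.2)].
  have [f [g fg]] : exists f g, (1 + `|c|) * h2_norm f * h2_norm g < h2_norm (b f g).
    apply: contrapT => bounded; apply: unbounded; exists (1 + `|c|).
      by rewrite ltr_pwDl.
    move=> f g; rewrite leNgt; apply/negP => fg.
    by apply: bounded; exists f, g.
  have gt0 f' g' : 0 < h2_norm (b f' g') -> 0 < h2_norm g'.
    move=> b0; rewrite lt0r h2_norm_ge0 andbT; apply/eqP => g0.
    by have := lt_le_trans b0 (bN f' g'); rewrite g0 mulr0 ltxx.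
  have bfg0 : 0 < h2_norm (b f g).
    by rewrite (le_lt_trans _ fg) // !mulr_ge0 ?h2_norm_ge0 ?addr_ge0.
  have g0 := gt0 _ _ bfg0; have f0 : 0 < h2_norm f by apply: (gt0 g); rewrite bC.
  have unit_norm h : 0 < h2_norm h -> h2_norm ((h2_norm h)^-1%:C *: h) <= 1.
    by move=> h0; rewrite h2_normZ normc_real ger0_norm
      ?invr_ge0 ?(ltW h0) // mulVf ?gt_eqF.
  exists ((h2_norm f)^-1%:C *: f, (h2_norm g)^-1%:C *: g); split; try exact: unit_norm.
  rewrite /= (le_lt_trans (ler_norm c)) //.
  set b1 := b _ _.
  have bE : b f g = (h2_norm f * h2_norm g)%:C *: b1.
    rewrite /b1 /= bZ (bC (_ *: f)) bZ (bC g) !scalerA -!rmorphM /=.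
    by rewrite mulrA mulfK ?gt_eqF // mulfV ?gt_eqF // scale1r.
  move: fg; rewrite bE h2_normZ normc_real [`|_ * _|]ger0_norm ?mulr_ge0 ?ltW //.
  rewrite -mulrA [ltLHS]mulrC ltr_pM2l ?mulr_gt0 // => /(le_lt_trans _) -> //.
  by rewrite lerDr.
have [w w_spec] := choice witness.
(* The state at stage [n] is the partial sum [x n] with the next weight [d n]. *)
pose next n (s : H2 beta * R) := w ((`|N s.1| + n%:R + 1) / s.2).
pose st := fix st n := if n is n'.+1 then
  let s := st n' in let gf := next n' s in
  (s.1 + s.2%:C *: gf.2, s.2 / (2 * (1 + `|N gf.1|))) else (0, 1).
pose x n := (st n).1; pose d n := (st n).2.
pose g n := (next n (st n)).1; pose f n := (next n (st n)).2.
have xS n : x n.+1 = x n + (d n)%:C *: f n by [].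
have dS n : d n.+1 = d n / (2 * (1 + `|N (g n)|)) by [].
have g1 n : h2_norm (g n) <= 1.
  by rewrite /g /next; have [] := w_spec ((`|N (x n)| + n%:R + 1) / d n).
have f1 n : h2_norm (f n) <= 1.
  by rewrite /f /next; have [] := w_spec ((`|N (x n)| + n%:R + 1) / d n).
have d0 n : 0 < d n.
  by elim: n => [|n IHn]; rewrite ?dS ?divr_gt0 ?mulr_gt0 ?ltr_pwDl.
have gf_big n : `|N (x n)| + n%:R + 1 < d n * h2_norm (b (g n) (f n)).
  rewrite mulrC -ltr_pdivrMr //.
  by rewrite /g /f /next; have [] := w_spec ((`|N (x n)| + n%:R + 1) / d n).
have d_half n : 2 * d n.+1 <= d n.
  have N0 : 0 < 1 + `|N (g n)| by rewrite ltr_pwDl.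
  have -> : 2 * d n.+1 = d n / (1 + `|N (g n)|) by rewrite dS; field; rewrite gt_eqF.
  rewrite ler_pdivrMr //.
  by rewrite ler_pMr // lerDl.
have d1 n : d n <= 1.
  elim: n => // n IHn; rewrite (le_trans _ IHn) // (le_trans _ (d_half n)) //.
  by rewrite ler_pMl ?ler1n.
have [n|y yx] := @h2_complete x d d_half.
  rewrite xS addrC addKr h2_normZ normc_real ger0_norm ?(ltW (d0 n)) //.
  by rewrite (le_trans _ (ler_piMr (ltW (d0 n)) (f1 n))).
have := archi_boundP (normr_ge0 (N y)); set n := Num.bound _; apply/negP; rewrite -leNgt.
have bN' h z : h2_norm (b h z) <= `|N h| * h2_norm z.
  by rewrite (le_trans (bN h z)) // ler_wpM2r ?h2_norm_ge0 ?ler_norm.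
have Nle h : h2_norm (b h (g n)) <= `|N h|.
  by rewrite (le_trans (bN' h _)) // ler_piMr.
have tail : h2_norm (b (g n) (y - x n.+1)) <= 1.
  rewrite (le_trans (bN' _ _)) // (le_trans (ler_wpM2l (normr_ge0 _) (yx _))) // dS.
  have -> : `|N (g n)| * (2 * (d n / (2 * (1 + `|N (g n)|)))) =
            d n * (`|N (g n)| / (1 + `|N (g n)|)).
    by field; rewrite gt_eqF // ltr_pwDl.
  have N0 : 0 < 1 + `|N (g n)| by rewrite ltr_pwDl.
  apply: mulr_ile1 => //; first exact: ltW.
  by rewrite ler_pdivrMr // mul1r lerDr.
(* The [n]-th term is what remains of [y] without the later and earlier ones. *)
have hump : (d n)%:C *: b (g n) (f n) = b y (g n) - b (g n) (y - x n.+1) - b (x n) (g n).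
  rewrite -bZ; have := xS n; move: ((d n)%:C *: f n) => z ->.
  apply/esym/eqP; rewrite !subr_eq; apply/eqP.
  by rewrite bC [b (x n) _]bC -!bD addrC [z + _]addrC subrK.
have : d n * h2_norm (b (g n) (f n)) <= `|N y| + 1 + `|N (x n)|.
  rewrite (_ : _ * _ = h2_norm ((d n)%:C *: b (g n) (f n))); last first.
    by rewrite h2_normZ normc_real ger0_norm // ltW.
  rewrite hump (le_trans (h2_normD beta_gt0 _ _)) // h2_normN lerD //.
  by rewrite (le_trans (h2_normD beta_gt0 _ _)) // h2_normN lerD.
move: (gf_big n); lra.
Qed.

End Completeness.

(** * Formal products of power series *)

Section CauchyProduct.
Variable R : realType.
Implicit Types a b c : nat -> R[i].

(** Truncation to polynomials transfers the ring identities of [{poly R[i]}] to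
    formal power series. *)
Lemma cauchy_prod_poly a b n N : (n < N)%N ->
  cauchy_prod a b n = ((\poly_(i < N) a i) * (\poly_(i < N) b i))`_n.
Proof.
move=> nN; rewrite coefM; apply: eq_bigr => k _; rewrite !coef_poly.
by rewrite (leq_ltn_trans _ nN) ?leq_ord // (leq_ltn_trans (leq_subr _ _) nN).
Qed.

Lemma cauchy_prodC a b : cauchy_prod a b = cauchy_prod b a.
Proof.
by apply/funext => n; rewrite !(@cauchy_prod_poly _ _ n n.+1) // mulrC.
Qed.

Lemma cauchy_prodA a b c :
  cauchy_prod a (cauchy_prod b c) = cauchy_prod (cauchy_prod a b) c.
Proof.
apply/funext => n; pose p (u : nat -> R[i]) := \poly_(i < n.+1) u i.
have pE u k : (k <= n)%N -> u k = (p u)`_k by move=> kn; rewrite coef_poly ltnS kn.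
transitivity ((p a * (p b * p c))`_n).
  rewrite coefM; apply: eq_bigr => k _; rewrite -pE ?leq_ord //.
  by rewrite (@cauchy_prod_poly _ _ _ n.+1) // ltnS leq_subr.
rewrite mulrA coefM; apply: eq_bigr => k _; rewrite -pE ?leq_subr //.
by rewrite (@cauchy_prod_poly _ _ _ n.+1).
Qed.

Lemma cauchy_prod1 a : cauchy_prod (fun k => (k == 0%N)%:R) a = a.
Proof.
apply/funext => n; rewrite /cauchy_prod big_ord_recl /= mul1r subn0 big1 ?addr0 //.
by move=> k _; rewrite mul0r.
Qed.

Lemma cauchy_prodX a n :
  cauchy_prod (fun k => (k == 1%N)%:R) a n = if n is m.+1 then a m else 0.
Proof.
rewrite /cauchy_prod; case: n => [|n]; first by rewrite big_ord1 mul0r.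
rewrite !big_ord_recl /= mul0r add0r mul1r subSS subn0 big1 ?addr0 // => k _.
by rewrite mul0r.
Qed.

Lemma cauchy_prodDr a b c :
  cauchy_prod a (fun n => b n + c n) = fun n => cauchy_prod a b n + cauchy_prod a c n.
Proof.
by apply/funext => n; rewrite -big_split; apply: eq_bigr => k _; rewrite mulrDr.
Qed.

Lemma cauchy_prodZr (k : R[i]) a b :
  cauchy_prod a (fun n => k * b n) = fun n => k * cauchy_prod a b n.
Proof.
by apply/funext => n; rewrite mulr_sumr; apply: eq_bigr => j _; rewrite mulrCA.
Qed.

Lemma cauchy_prod_sum a N (c : nat -> R[i]) (b : nat -> nat -> R[i]) n :
  cauchy_prod (fun k => \sum_(i < N) c i * b i k) a n =
  \sum_(i < N) c i * cauchy_prod (b i) a n.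
Proof.
rewrite /cauchy_prod; under eq_bigr do rewrite mulr_suml.
rewrite exchange_big; apply: eq_bigr => i _; rewrite mulr_sumr.
by apply: eq_bigr => k _; rewrite mulrA.
Qed.
End CauchyProduct.

(** * Bounded operators and polynomial approximation *)

Section Shift.
Variables (R : realType) (beta : nat -> R).
Hypothesis beta_gt0 : forall n, 0 < beta n.

Definition h2_trunc n (f : H2 beta) : H2 beta := \sum_(k < n) f k *: h2_mon beta k.

Lemma h2_truncE n (f : H2 beta) k : h2_trunc n f k = if (k < n)%N then f k else 0.
Proof.
rewrite h2_coef_sum; under eq_bigr do rewrite h2_coefZ /=.
case: ltnP => kn; last first.
  by rewrite big1 // => i _; rewrite gtn_eqF ?mulr0 // (leq_trans _ kn).
rewrite (bigD1 (Ordinal kn)) //= eqxx mulr1 big1 ?addr0 // => i ik.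
by rewrite eq_sym (negbTE _ : (i == k :> nat) = false) ?mulr0.
Qed.

(** Polynomials are dense: the squared norm of a tail is what the convergent
    series [psum2 beta f] still has to gain. *)
Lemma h2_tail (f : H2 beta) e : 0 < e -> exists N, forall n, (N <= n)%N ->
  h2_norm (f - h2_trunc n f) <= e.
Proof.
move=> e0; pose L := limn (psum2 beta f).
have ndf := psum2_nd beta f.
have cf : cvgn (psum2 beta f) by exact: h2_cvg.
have fL n : psum2 beta f n <= L by apply: nondecreasing_cvgn_le.
have [N _ NL] : \forall n \near \oo, L - e ^+ 2 < psum2 beta f n.
  by apply: (cvgr_gt _ cf); rewrite ltrBlDr ltrDl exprn_gt0.
exists N => n Nn; apply: h2_norm_le; first exact: ltW.
move=> m; have tailE k : psum2 beta (f - h2_trunc n f) (n + k) =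
    psum2 beta f (n + k) - psum2 beta f n.
  elim: k => [|k IHk].
    rewrite addn0 subrr /psum2 big1 // => j _.
    by rewrite h2_coefB h2_truncE ltn_ord subrr normc0 expr0n mul0r.
  rewrite addnS {1}/psum2 big_ord_recr h2_coefB h2_truncE /= -/(psum2 _ _ _) IHk.
  rewrite [in RHS]/psum2 [in RHS]big_ord_recr /= -!/(psum2 _ _ _) addrAC.
  by rewrite ltnNge leq_addr subr0.
apply: (le_trans (psum2_nd _ _ (leq_addl n m))); rewrite tailE.
rewrite lerBlDr -lerBlDl (le_trans _ (ltW (NL n Nn))) // lerB //.
Qed.

Lemma bop_bound (T : bounded_op beta) :
  exists2 K : R, 0 <= K & forall f, h2_norm (T f) <= K * h2_norm f.
Proof.
have [K TK] := bop_bounded T; exists `|K| => // f.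
by rewrite (le_trans (TK f)) // ler_wpM2r ?h2_norm_ge0 ?ler_norm.
Qed.

(** [Mz] is only known on monomials; boundedness extends the formula to the
    limits of polynomials, one coefficient at a time. *)
Lemma Mz_shift (Mz : bounded_op beta) (f : H2 beta) :
  (forall n, Mz (h2_mon beta n) = h2_mon beta n.+1) ->
  (Mz f : nat -> R[i]) = cauchy_prod (h2_mon beta 1) f.
Proof.
move=> MzE; apply/funext => j; have [K K0 MzK] := bop_bound Mz.
apply/eqP; rewrite -subr_eq0; apply/eqP/eq0_normc/eqP.
rewrite eq_le normc_ge0 andbT -(pmulr_lle0 _ (beta_gt0 j)).
apply: (@le0_small _ K) => e e0; have [N fN] := h2_tail f e0.
pose n := (N + j)%N.
rewrite (le_trans _ (ler_wpM2l K0 (fN n (leq_addr _ _)))) // (le_trans _ (MzK _)) //.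
rewrite (le_trans _ (h2_coef_le beta_gt0 _ j)) // linearB h2_coefB.
rewrite (_ : h2_coef (Mz (h2_trunc n f)) j = cauchy_prod (h2_mon beta 1) f j) //.
rewrite cauchy_prodX linear_sum h2_coef_sum.
under eq_bigr do rewrite linearZ MzE h2_coefZ /=.
rewrite /n; case: j {n} => [|j]; first by rewrite big1 // => i _; rewrite mulr0.
have jn : (j < N + j.+1)%N by rewrite addnS ltnS leq_addl.
rewrite (bigD1 (Ordinal jn)) //= eqxx mulr1 big1 ?addr0 // => i ij.
by rewrite eqSS eq_sym (negbTE _ : (i == j :> nat) = false) ?mulr0.
Qed.

End Shift.

(** * The weakly closed algebra of an operator *)

Section WeakOperatorClosure.
Variables (R : realType) (beta : nat -> R).
Hypothesis beta_gt0 : forall n, 0 < beta n.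

Lemma h2_dot_mon (g : H2 beta) n :
  h2_dot g (h2_mon beta n) = g n * (beta n ^+ 2)%:C.
Proof.
rewrite /h2_dot; apply: lim_near_cst; first exact: norm_hausdorff.
near=> m; rewrite /series /= big_mkord.
have nm : (n < m)%N by near: m; exact: nbhs_infty_gt.
rewrite (bigD1 (Ordinal nm)) //= eqxx rmorph1 mulr1 big1 ?addr0 // => i ni.
rewrite (negbTE _ : (i == n :> nat) = false) ?rmorph0 ?mulr0 ?mul0r //.
Unshelve. all: by end_near. Qed.

Lemma op_coef_continuous (f g : H2 beta) :
  continuous ((fun A : bounded_op beta => h2_dot (A f) g) : wot beta -> R[i]).
Proof.
move=> A; apply: (@continuous_comp (wot beta) {ptws (H2 beta * H2 beta) -> R[i]} R[i]
  (@op_coef R beta) (fun u => u (f, g))).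
  exact: initial_continuous.
exact: (@proj_continuous _ (fun=> R[i]) (f, g)).
Qed.

Lemma wot_coef_continuous (f : H2 beta) n :
  continuous ((fun A : bounded_op beta => (A f : H2 beta) n) : wot beta -> R[i]).
Proof.
have bn0 : (beta n ^+ 2)%:C != 0 :> R[i].
  by rewrite (inj_eq (@complexI R)) expf_neq0 // gt_eqF.
rewrite (_ : (fun A => _) = (fun A : wot beta =>
  h2_dot ((A : bounded_op beta) f) (h2_mon beta n) * (beta n ^+ 2)%:C^-1)); last first.
  by apply/funext => A; rewrite h2_dot_mon mulfK.
move=> A; apply: cvgMr_tmp; first exact: (@nbhs_filter (wot beta) A).
exact: op_coef_continuous.
Qed.

(** Each coefficient of [A f] is a multiple of a matrix coefficient of [A], and
    the identity at index [n] involves finitely many of them: it defines a weakly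
    closed set of operators. *)
Lemma wot_coef_prod (T : bounded_op beta) (f h : H2 beta) :
  (forall A, poly_ops T A -> A f = cauchy_prod (A h) f :> (nat -> R[i])) ->
  forall A, wot_algebra T A -> A f = cauchy_prod (A h) f :> (nat -> R[i]).
Proof.
move=> Tf A clA; apply/funext => n; apply/eqP; rewrite -subr_eq0; apply/eqP.
pose D (B : bounded_op beta) := (B f : H2 beta) n - cauchy_prod (B h) f n.
have cD : continuous (D : wot beta -> R[i]).
  move=> B; have FB := @nbhs_filter (wot beta) B.
  apply: cvgB; first exact: wot_coef_continuous.
  apply: cvg_big => [|k _]; first exact: add_continuous.
  by apply: cvgMr_tmp; exact: wot_coef_continuous.
have closedD : closed ((D : wot beta -> R[i]) @^-1` [set 0]).
  apply: preimage_closed => //; apply: accessible_closed_set1.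
  by apply: hausdorff_accessible; exact: norm_hausdorff.
rewrite -/(D A); suff : wot_algebra T `<=` D @^-1` [set 0] by apply.
rewrite /wot_algebra closureE; apply: smallest_sub => // B TB.
by rewrite /= /D Tf // subrr.
Qed.

Lemma bop_sum_bound (T : bounded_op beta) (c : nat -> R[i]) N :
  exists2 K : R, 0 <= K &
    forall f, h2_norm (\sum_(k < N) c k *: iter k T f) <= K * h2_norm f.
Proof.
have [K K0 TK] := bop_bound T.
have iterK k f : h2_norm (iter k T f) <= K ^+ k * h2_norm f.
  elim: k => [|k IHk]; first by rewrite mul1r.
  by rewrite iterS (le_trans (TK _)) // exprS -mulrA ler_wpM2l.
elim: N => [|N [L L0 IHN]].
  by exists 0 => // f; rewrite big_ord0 h2_norm0 mul0r.
exists (L + normc (c N) * K ^+ N) => [|f].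
  by rewrite addr_ge0 ?mulr_ge0 ?normc_ge0 ?exprn_ge0.
rewrite big_ord_recr /= (le_trans (h2_normD beta_gt0 _ _)) // mulrDl lerD //.
by rewrite h2_normZ -mulrA ler_wpM2l ?normc_ge0 ?iterK.
Qed.

End WeakOperatorClosure.

(** * Strict cyclicity makes the space a normed algebra *)

Section StrictlyCyclic.
Variables (R : realType) (beta : nat -> R).
Hypothesis beta_gt0 : forall n, 0 < beta n.
Variable Mz : bounded_op beta.
Hypothesis MzE : forall n, Mz (h2_mon beta n) = h2_mon beta n.+1.

Lemma iter_Mz_mon k : iter k Mz (h2_mon beta 0) = h2_mon beta k.
Proof. by elim: k => //= k ->; rewrite MzE. Qed.

Lemma iter_Mz_prod k (f : H2 beta) :
  iter k Mz f = cauchy_prod (h2_mon beta k) f :> (nat -> R[i]).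
Proof.
elim: k => [|k IHk]; first by rewrite cauchy_prod1.
rewrite iterS (Mz_shift beta_gt0 _ MzE) IHk cauchy_prodA; congr cauchy_prod.
by rewrite -(MzE k) (Mz_shift beta_gt0 _ MzE).
Qed.

Lemma sum_iter_Mz_prod (c : nat -> R[i]) N (f : H2 beta) :
  \sum_(k < N) c k *: iter k Mz f =
  cauchy_prod (\sum_(k < N) c k *: h2_mon beta k : H2 beta) f :> (nat -> R[i]).
Proof.
apply/funext => n; rewrite h2_coef_sum.
under eq_bigr do rewrite h2_coefZ iter_Mz_prod.
rewrite -(cauchy_prod_sum f N c (fun i => h2_mon beta i)).
congr (cauchy_prod _ _ _); apply/funext => k.
by rewrite h2_coef_sum; apply: eq_bigr => i _; rewrite h2_coefZ.
Qed.

Lemma wot_algebra_Mz (A : bounded_op beta) (f : H2 beta) : wot_algebra Mz A ->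
  A f = cauchy_prod (A (h2_mon beta 0)) f :> (nat -> R[i]).
Proof.
move=> MzA; apply: (wot_coef_prod beta_gt0 _ MzA) => B [p Bp].
rewrite !Bp sum_iter_Mz_prod; congr (cauchy_prod (h2_coef _) f).
by apply: eq_bigr => k _; rewrite iter_Mz_mon.
Qed.

(** Everything happens in the ring of formal power series, where the symmetric
    form [A g f = phi g f] of the cyclic representation shows that multiplication
    by [phi g] is bounded with a norm controlled by that of [g].  It remains to
    trade [phi] for 1, which a polynomial close to [x0 = phi^-1] achieves: it is
    almost inverse to [phi] and, contrary to [x0], visibly a bounded
    multiplier. *)
Lemma strictly_cyclic_prod : strictly_cyclic Mz ->
  exists2 C : R, 0 < C & forall f g : H2 beta, exists2 h : H2 beta,
    h = cauchy_prod f g :> (nat -> R[i]) & h2_norm h <= C * h2_norm f * h2_norm g.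
Proof.
move=> [x0 x0_cyclic].
have /choice[A A_spec] (g : H2 beta) : exists A, wot_algebra Mz A /\ A x0 = g.
  have : [set (A : bounded_op beta) x0 | A in wot_algebra Mz] g by rewrite x0_cyclic.
  by case=> A MzA <-; exists A.
pose one := h2_mon beta 0; pose phi := A one one.
have prod1 (a : nat -> R[i]) : cauchy_prod one a = a := cauchy_prod1 a.
have AE g f : A g f = cauchy_prod (A g one) f :> (nat -> R[i]).
  by apply: wot_algebra_Mz; have [] := A_spec g.
have phi_x0 : cauchy_prod phi x0 = one.
  by rewrite /phi -AE; have [_ ->] := A_spec one.
have A_phi g f : A g f = cauchy_prod phi (cauchy_prod g f) :> (nat -> R[i]).
  rewrite AE cauchy_prodA; congr cauchy_prod.
  have [_ {2}<-] := A_spec g; rewrite (AE g x0) cauchy_prodC -cauchy_prodA.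
  by rewrite [cauchy_prod x0 _]cauchy_prodC phi_x0 cauchy_prodC prod1.
clearbody phi.
have AC f g : A f g = A g f.
  by apply: h2P => n; rewrite (A_phi f) (A_phi g) [cauchy_prod f g]cauchy_prodC.
have [|f|C0 C0_gt0 AC0] := h2_bilinear_bounded beta_gt0 AC.
- by move=> f c g h; rewrite linearP.
- by have [K _ AK] := bop_bound (A f); exists K.
have [N /(_ N (leqnn _)) x0N] := h2_tail x0 (divr_gt0 ltr01 (mulr_gt0 (ltr0Sn R 1) C0_gt0)).
(* [phi p = 1 + phi e], where multiplication by [phi e] has norm at most 1/2. *)
set p := h2_trunc N x0 in x0N; pose e := p - x0.
have e_small : h2_norm e <= 1 / (2 * C0) by rewrite h2_normB.
have Te x : 2 * h2_norm (A e x) <= h2_norm x.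
  rewrite (le_trans (ler_wpM2l _ (AC0 e x))) // !mulrA ler_piMl ?h2_norm_ge0 //.
  by move: e_small; rewrite ler_pdivlMr ?mulr_gt0 // mulrC.
have [K K0 PK] := bop_sum_bound beta_gt0 Mz x0 N.
exists (2 * K * C0 + 1) => [|g f].
  by rewrite ltr_wpDl // !mulr_ge0 // ltW.
(* So [g = phi p h], and then [g f = p (phi h f)]. *)
have [h [hg h_le]] := h2_neumann beta_gt0 g (fun x y => linearB (A e) x y) Te.
exists (\sum_(k < N) x0 k *: iter k Mz (A h f)).
  rewrite sum_iter_Mz_prod -/(h2_trunc N x0) -/p A_phi !cauchy_prodA.
  congr cauchy_prod; rewrite -cauchy_prodA cauchy_prodC.
  have -> : p = (fun n => x0 n + e n) :> (nat -> R[i]).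
    by apply/funext => n; rewrite h2_coefB addrC subrK.
  rewrite cauchy_prodDr; apply/funext => n.
  rewrite -cauchy_prodA [cauchy_prod h x0]cauchy_prodC cauchy_prodA phi_x0 prod1.
  by rewrite -cauchy_prodA [cauchy_prod h e]cauchy_prodC -A_phi -h2_coefD hg.
rewrite (le_trans (PK _)) // (le_trans (ler_wpM2l K0 (AC0 h f))) // mulrA.
rewrite ler_wpM2r ?h2_norm_ge0 // mulrA.
rewrite (le_trans (ler_wpM2l (mulr_ge0 K0 (ltW C0_gt0)) h_le)) //.
by have := h2_norm_ge0 g; lra.
Qed.
End StrictlyCyclic.

(** * The theorem of Gleason, Kahane and Zelazko *)

Section Gleason_Kahane_Zelazko.
Variables (R : realType) (A : comAlgType R[i]) (F : {scalar A}).

(** Newton's identity for the first two elementary symmetric functions; the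
    factors [1 - m X] keep the relevant coefficients in degrees independent of
    the length of [s]. *)
Lemma coef012_prod_1subX (K : comNzRingType) (s : seq K) :
  let p := \prod_(m <- s) (1 - m%:P * 'X) : {poly K} in
  [/\ p`_0 = 1, p`_1 = - \sum_(m <- s) m &
      p`_2 *+ 2 = (\sum_(m <- s) m) ^+ 2 - \sum_(m <- s) m ^+ 2].
Proof.
elim: s => [|m s /= [IH0 IH1 IH2]] /=.
  by rewrite !big_nil !coef1 oppr0 mul0rn expr0n addr0.
rewrite !big_cons; set p := \prod_(j <- s) _ in IH0 IH1 IH2 *.
have coefS k : ((1 - m%:P * 'X) * p)`_k.+1 = p`_k.+1 - m * p`_k.
  by rewrite mulrBl mul1r coefB -mulrA coefCM coefXM.
split.
- by rewrite mulrBl mul1r coefB -mulrA coefCM coefXM /= mulr0 subr0.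
- by rewrite coefS IH0 IH1 mulr1 opprD addrC.
- rewrite coefS IH1 mulrnBl IH2; ring.
Qed.

(** The [m] are the inverses of the roots, none of which is 0 as the constant
    coefficient is 1. *)
Lemma prod_1subX_of_coef0 (p : {poly R[i]}) : p`_0 = 1 ->
  exists s : seq R[i], [/\ p = \prod_(m <- s) (1 - m%:P * 'X),
    (size s < size p)%N & forall m, m \in s -> m != 0 /\ root p m^-1].
Proof.
move=> p0; have pN0 : p != 0.
  by apply/eqP => p00; move: p0; rewrite p00 coef0 => /esym/eqP; rewrite oner_eq0.
have [rs prs] := closed_field_poly_normal p.
have rsN0 t : t \in rs -> t != 0.
  move=> trs; apply/eqP => t0; have : root p t.
    by rewrite prs rootZ ?lead_coef_eq0 // root_prod_XsubC.
  by rewrite t0 /root horner_coef0 p0 oner_eq0.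
have rsp : p = (lead_coef p * \prod_(t <- rs) - t)%:P *
               \prod_(t <- rs) (1 - (t^-1)%:P * 'X).
  rewrite {1}prs polyCM -mulrA mul_polyC rmorph_prod -big_split /=; congr (_ *: _).
  apply: eq_big_seq => t trs.
  rewrite mulrBr mulr1 polyCN mulNr opprK mulrA -polyCM mulfV ?rsN0 // mul1r.
  by rewrite addrC.
have c1 : lead_coef p * \prod_(t <- rs) - t = 1.
  have [+ _ _] := coef012_prod_1subX (map (fun t => t^-1) rs).
  rewrite big_map => c0; rewrite -[LHS]mulr1 -[X in _ * X]c0 -coefCM.
  by rewrite -rsp p0.
exists [seq t^-1 | t <- rs]; split.
- by rewrite big_map {1}rsp c1 mul1r.
- by rewrite size_map {1}prs size_scale ?lead_coef_eq0 // size_prod_XsubC.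
- move=> _ /mapP[t trs ->]; split; first by rewrite invr_eq0 rsN0.
  by rewrite invrK prs rootZ ?lead_coef_eq0 // root_prod_XsubC.
Qed.

Hypothesis F1 : F 1 = 1.
Hypothesis F_pow : forall x : A, exists2 r : R, 0 < r &
  forall (t : R[i]) n, normc t <= r -> F ((1 + t *: x) ^+ n) <> 0.

(** The elementary argument of Roitman and Sternfeld, which replaces the entire
    function [F (exp (t x))] and Hadamard factorization by polynomials. *)
Lemma scalar_sqr_eq0 (x : A) : F x = 0 -> F (x ^+ 2) = 0.
Proof.
move=> Fx0; have [r r0 Fr] := F_pow x.
apply: eq0_normc; apply/eqP; rewrite eq_le normc_ge0 andbT leNgt; apply/negP => Fx2.
(* Doubling the degree 2 coefficient at exponent [n.+2] gives
   [n.+2 n.+1 F (x ^+ 2)], against at most [n.+2] squares below [r^-2]. *)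
have key n : n.+1%:R * normc (F (x ^+ 2)) <= r^-1 ^+ 2.
  pose p : {poly R[i]} := \poly_(k < n.+3) (F (x ^+ k) *+ 'C(n.+2, k)).
  have pE t : p.[t] = F ((1 + t *: x) ^+ n.+2).
    rewrite horner_poly exprDn linear_sum; apply: eq_bigr => k _.
    by rewrite expr1n mul1r exprZn linearMn linearZ /= mulrnAl mulrC.
  have p0 : p`_0 = 1 by rewrite coef_poly /= expr0 F1 bin0.
  have [s [ps size_s rs]] := prod_1subX_of_coef0 p0.
  have [_ s1 s2] := coef012_prod_1subX s.
  move: s1 s2; rewrite -ps !coef_poly /= expr1 Fx0 mul0rn.
  move=> /esym/eqP; rewrite oppr_eq0 => /eqP ->; rewrite expr0n sub0r /=.
  rewrite -mulrnA mulnC -mul_bin_diag bin1 => Fs.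
  have sr : normc (\sum_(m <- s) m ^+ 2) <= (size s)%:R * r^-1 ^+ 2.
    rewrite (le_trans (le_normc_sum _ _)) // big_seq.
    rewrite -sum1_size natr_sum mulr_suml [leRHS]big_seq ler_sum // => m ms.
    have [m0 /eqP pm] := rs _ ms; rewrite normcX mul1r lerXn2r ?nnegrE ?normc_ge0 //.
      by rewrite invr_ge0 ltW.
    rewrite leNgt; apply/negP => rm; apply: (Fr m^-1 n.+2); last by rewrite -pE.
    by rewrite normcV invf_ple ?posrE ?(lt_trans _ rm) ?invr_gt0 // ltW.
  have sn : (size s <= n.+2)%N by rewrite -ltnS (leq_trans size_s) // size_poly.
  have := congr1 (@normc R) Fs; rewrite normcMn normcN => Fs'.
  rewrite -(ler_pM2l (ltr0Sn R n.+1)) mulrA -natrM mulr_natl Fs'.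
  by rewrite (le_trans sr) // ler_wpM2r ?sqr_ge0 // ler_nat.
have := archi_boundP (divr_ge0 (sqr_ge0 r^-1) (ltW Fx2)).
set n := Num.bound _ => ltn.
have := key n; apply/negP; rewrite -ltNge -ltr_pdivrMr //.
by rewrite (lt_trans ltn) // ltr_nat.
Qed.

Lemma scalar_multiplicative (x y : A) : F (x * y) = F x * F y.
Proof.
(* Apply the lemma to [z - F z], which is in the kernel; then polarize. *)
have Fsqr z : F (z ^+ 2) = F z ^+ 2.
  have := @scalar_sqr_eq0 (z - F z *: 1); rewrite linearB linearZ /= F1 mulr1 subrr.
  move=> /(_ erefl); rewrite sqrrB -scalerAr mulr1 exprZn expr1n.
  rewrite linearD linearB raddfMn !linearZ /= F1 mulr1 => /eqP.
  rewrite linearZ /= -expr2 mulr2n opprD addrA subrK subr_eq0.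
  by move/eqP.
have := Fsqr (x + y); rewrite linearD !sqrrD !linearD.
rewrite -mulr2n !Fsqr.
move=> /addIr /addrI /eqP; rewrite -subr_eq0 -mulrnBl mulrn_eq0 /= subr_eq0.
by move=> /eqP.
Qed.
End Gleason_Kahane_Zelazko.

(** * The algebra structure and its invertible elements *)

Definition h2_closed (R : realType) (beta : nat -> R) :=
  forall f g : H2 beta, cauchy_prod f g \in h2_summable beta.

(** An alias of [H2 beta], since the ring structure depends on the hypothesis
    that products stay in the space. *)
Definition H2alg (R : realType) (beta : nat -> R) (cl : h2_closed beta) := H2 beta.

Section Algebra.
Variables (R : realType) (beta : nat -> R) (cl : h2_closed beta).

HB.instance Definition _ := GRing.Lmodule.on (H2alg cl).

Definition h2_mul (f g : H2alg cl) : H2alg cl := MkH2 (cl f g).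

Lemma h2_mulA : associative h2_mul.
Proof. by move=> f g h; apply: val_inj; rewrite /= cauchy_prodA. Qed.

Lemma h2_mulC : commutative h2_mul.
Proof. by move=> f g; apply: val_inj; rewrite /= cauchy_prodC. Qed.

Lemma h2_mul1 : left_id (h2_mon beta 0 : H2alg cl) h2_mul.
Proof. by move=> f; apply: val_inj; rewrite /= cauchy_prod1. Qed.

Lemma h2_mulDl : left_distributive h2_mul +%R.
Proof.
move=> f g h; rewrite !(h2_mulC _ h); apply: val_inj.
by rewrite /= cauchy_prodDr.
Qed.

Lemma h2_1neq0 : (h2_mon beta 0 : H2alg cl) != 0.
Proof.
by apply/eqP => /(congr1 (fun f : H2 beta => f 0%N))/eqP; rewrite /= oner_eq0.
Qed.

HB.instance Definition _ := GRing.Zmodule_isComNzRing.Build (H2alg cl)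
  h2_mulA h2_mulC h2_mul1 h2_mulDl h2_1neq0.

Lemma h2_scaleAl (c : R[i]) (f g : H2alg cl) : c *: (f * g) = (c *: f) * g.
Proof.
by rewrite ![_ * g]mulrC; apply: val_inj; rewrite /= cauchy_prodZr.
Qed.

HB.instance Definition _ := GRing.Lmodule_isLalgebra.Build R[i] (H2alg cl) h2_scaleAl.
HB.instance Definition _ := GRing.Lalgebra_isComAlgebra.Build R[i] (H2alg cl).

Lemma h2_mulE (f g : H2alg cl) : f * g = cauchy_prod f g :> (nat -> R[i]).
Proof. by []. Qed.

Lemma h2_mulr_invertible (f g : H2alg cl) : f * g = 1 -> h2_invertible f.
Proof. by move=> fg; exists g; rewrite -h2_mulE fg. Qed.
End Algebra.

Section BoundedAlgebra.
Variables (R : realType) (beta : nat -> R) (cl : h2_closed beta).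
Hypothesis beta_gt0 : forall n, 0 < beta n.
Variable C : R.
Hypothesis C_gt0 : 0 < C.
Hypothesis mul_le : forall f g : H2alg cl, h2_norm (f * g) <= C * h2_norm f * h2_norm g.

Lemma h2_1D_inv (x : H2alg cl) : 2 * C * h2_norm x <= 1 ->
  exists y : H2alg cl, (1 + x) * y = 1.
Proof.
move=> x_small.
have [||y [xy _]] := @h2_neumann _ _ beta_gt0 ( *%R x) (1 : H2alg cl).
- by move=> f g; rewrite mulrBr.
- move=> f; rewrite (le_trans (ler_wpM2l _ (mul_le x f))) //.
  by rewrite !mulrA ler_piMl ?h2_norm_ge0.
by exists y; rewrite mulrDl mul1r.
Qed.

Lemma h2_subc_inv (x : H2alg cl) (l : R[i]) : 2 * C * h2_norm x < normc l ->
  exists y : H2alg cl, (x - l *: 1) * y = 1.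
Proof.
move=> xl; have l0 : 0 < normc l.
  by rewrite (le_lt_trans _ xl) // !mulr_ge0 ?h2_norm_ge0 ?ltW.
have lN0 : l != 0 by apply: contraTneq l0 => ->; rewrite normc0 ltxx.
have [|y xy] := @h2_1D_inv (- l^-1 *: x).
  by rewrite h2_normZ normcN normcV mulrCA mulrC ler_pdivrMr // mul1r ltW.
exists (- l^-1 *: y); rewrite -[RHS]xy -scalerAr scalerAl; congr (_ * _).
by rewrite scalerBr scalerA mulNr mulVf // scaleN1r opprK addrC.
Qed.

Variables (F : {scalar H2alg cl}).
Hypothesis F1 : F 1 = 1.
Hypothesis F_inv : forall f : H2alg cl, h2_invertible f -> F f <> 0.

Lemma invertible_scalar_multiplicative (f g : H2alg cl) : F (f * g) = F f * F g.
Proof.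
apply: scalar_multiplicative => // x.
have r0 : 0 < 2 * C * h2_norm x + 1.
  by rewrite ltr_wpDl // !mulr_ge0 ?h2_norm_ge0 ?ltW.
exists (2 * C * h2_norm x + 1)^-1 => [|t n tr]; first by rewrite invr_gt0.
have [|y xy] := @h2_1D_inv (t *: x).
  rewrite h2_normZ mulrCA (le_trans (ler_wpM2r _ tr)) ?mulr_ge0 ?h2_norm_ge0 ?ltW //.
  by rewrite mulrC ltr_pdivrMr // mul1r ltrDl.
by apply: F_inv; apply: (@h2_mulr_invertible _ _ _ _ (y ^+ n)); rewrite -exprMn xy expr1n.
Qed.

(** If [F f] exceeded the bound, [f - F f] would be invertible, yet it lies in the
    kernel of [F]. *)
Lemma invertible_scalar_bounded (f : H2alg cl) : normc (F f) <= 2 * C * h2_norm f.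
Proof.
rewrite leNgt; apply/negP => /h2_subc_inv[y fy].
apply: (F_inv (h2_mulr_invertible fy)).
by rewrite linearB linearZ /= F1 mulr1 subrr.
Qed.

End BoundedAlgebra.

(** * The spectrum of the shift *)

Section Spectrum.
Variables (R : realType) (beta : nat -> R) (cl : h2_closed beta).
Hypothesis beta_gt0 : forall n, 0 < beta n.
Variable C : R.
Hypothesis C_gt0 : 0 < C.
Hypothesis mul_le : forall f g : H2alg cl, h2_norm (f * g) <= C * h2_norm f * h2_norm g.
Variable Mz : bounded_op beta.
Hypothesis MzE : forall n, Mz (h2_mon beta n) = h2_mon beta n.+1.

Lemma Mz_mul (f : H2alg cl) : Mz f = (h2_mon beta 1 : H2alg cl) * f.
Proof. by apply: h2P => n; rewrite (Mz_shift beta_gt0 _ MzE). Qed.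

Lemma h2_mul_bop (y : H2alg cl) : exists S : bounded_op beta, forall f : H2alg cl, S f = y * f.
Proof.
pose S (f : H2 beta) : H2 beta := y * (f : H2alg cl).
have S_lin : linear S by move=> c f g; rewrite /S mulrDr -scalerAr.
pose SL : {linear H2 beta -> H2 beta} :=
  HB.pack S (GRing.isLinear.Build _ _ _ _ S S_lin).
have SL_bounded : exists K : R, forall f, h2_norm (SL f) <= K * h2_norm f.
  by exists (C * h2_norm y) => f; apply: mul_le.
by exists (BoundedOp SL_bounded).
Qed.

(** Needed for the supremum defining the spectral radius to be meaningful: the
    resolvent at a large [l] is multiplication by the inverse of [z - l]. *)
Lemma spectrum_has_ubound : has_ubound [set normc l | l in spectrum Mz].
Proof.
exists (2 * C * h2_norm (h2_mon beta 1)) => _ [l sp_l <-].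
rewrite leNgt; apply/negP => /(h2_subc_inv beta_gt0 C_gt0 mul_le)[y zy].
apply: sp_l; have [S SE] := h2_mul_bop y; exists S => f.
have Mz_sub (g : H2alg cl) : Mz g - l *: g = ((h2_mon beta 1 : H2alg cl) - l *: 1) * g.
  by rewrite Mz_mul mulrBl -scalerAl mul1r.
by rewrite !Mz_sub !SE !mulrA [y * _]mulrC zy mul1r.
Qed.

(** A right inverse of [Mz - w], applied to 1, is an inverse of [z - w] in the
    algebra. *)
Lemma spectrum_of_scalar (F : {scalar H2alg cl}) (w : R[i]) :
  (forall f, h2_invertible f -> F f <> 0) ->
  F ((h2_mon beta 1 : H2alg cl) - w *: 1) = 0 -> spectrum Mz w.
Proof.
move=> F_inv Fw [S S_inv]; apply: (F_inv _ _ Fw).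
have [_] := S_inv (1 : H2alg cl); rewrite (Mz_mul (S (1 : H2alg cl))) => zS.
apply: (@h2_mulr_invertible _ _ _ _ (S (1 : H2alg cl))).
by rewrite mulrBl -scalerAl mul1r.
Qed.

End Spectrum.

(** * The functional is a point evaluation *)

Unset Implicit Arguments.

Theorem theoremC (R : realType) (beta : nat -> R)
    (beta_gt0 : forall n, 0 < beta n) (beta0 : beta 0%N = 1)
    (Mz : bounded_op beta)
    (MzE : forall n, Mz (h2_mon beta n) = h2_mon beta n.+1)
    (Mz_cyclic : strictly_cyclic Mz)
    (F : {scalar H2 beta})
    (F1 : F (h2_mon beta 0) = 1)
    (F_inv : forall f : H2 beta, h2_invertible f -> F f <> 0) :
  exists2 w : R[i], normc w <= spectral_radius Mz &
    forall f : H2 beta, series (fun n => f n * w ^+ n) @ \oo --> F f.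
Proof.
have [C C_gt0 prod_C] := strictly_cyclic_prod beta_gt0 MzE Mz_cyclic.
have cl : h2_closed beta.
  by move=> f g; have [h <- _] := prod_C f g; exact: h2_coefP.
have mul_le (f g : H2alg cl) : h2_norm (f * g) <= C * h2_norm f * h2_norm g.
  have [h hE] := prod_C f g.
  by rewrite (_ : f * g = h) //; apply: val_inj; rewrite /= hE.
pose FA : {scalar H2alg cl} := F; pose z : H2alg cl := h2_mon beta 1.
have FM := @invertible_scalar_multiplicative _ _ cl beta_gt0 C C_gt0 mul_le FA F1 F_inv.
have Fbound := @invertible_scalar_bounded _ _ cl beta_gt0 C C_gt0 mul_le FA F1 F_inv.
pose w := FA z; exists w.
  apply: ub_le_sup; first exact: (spectrum_has_ubound beta_gt0 C_gt0 mul_le MzE).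
  exists w => //; apply: (spectrum_of_scalar beta_gt0 MzE (F := FA) F_inv).
  by rewrite linearB linearZ /= F1 mulr1 subrr.
have FX k : F (h2_mon beta k) = w ^+ k.
  elim: k => [|k IHk]; first by rewrite F1.
  by rewrite -MzE (Mz_mul beta_gt0 MzE (h2_mon beta k : H2alg cl)) [LHS]FM exprS -IHk.
move=> f.
have Ftrunc n : series (fun k => f k * w ^+ k) n = F (h2_trunc n f).
  rewrite /series /= big_mkord linear_sum; apply: eq_bigr => k _.
  by rewrite linearZ /= FX.
apply/cvgrPdist_le => e e0.
(* The topology of [R[i]] measures distances by positive elements of [R[i]],
   which are real. *)
have eE : e = (complex.Re e)%:C by rewrite RRe_real // gtr0_real.
have e'0 : 0 < complex.Re e by rewrite -ltcR -eE.
have [N fN] := h2_tail f (divr_gt0 e'0 (mulr_gt0 (ltr0Sn R 1) C_gt0)).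
near=> n; have Nn : (N <= n)%N by near: n; exact: nbhs_infty_ge.
rewrite Ftrunc -linearB eE; suff : normc (F (f - h2_trunc n f)) <= complex.Re e.
  by rewrite -lecR.
rewrite (le_trans (Fbound _)) // mulrC -ler_pdivlMr ?mulr_gt0 //.
exact: fN.
Unshelve. all: by end_near. Qed.
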